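(* Let $S \in \mathscr{L}(A)$ be a Markov--Schwarz operator on a unital $\mathrm{C}^*$-algebra $A$. Moreover, let $x \in A$, let $(N_i)_{i \in I}$ be a subnet of $\mathbb{N}$, and let $\mu_i \in \mathrm{S}(A)$ be a state on $A$ for every $i \in I$. Then $$\limsup_{i} \left|\left\langle \frac{1}{N_i} \sum_{n=0}^{N_i-1} S^n x, \mu_i\right\rangle\right|^2 \leq \liminf_{J \to \infty} \frac{1}{J}\sum_{j=1}^{J} \limsup_{i} \frac{1}{N_i} \sum_{n=0}^{N_i-1} \operatorname{Re} \left\langle S^n\big((S^jx)^* x\big), \mu_i\right\rangle.$$
   Context: $\mathbb{N} = \{1,2,3,\dots\}$. $\mathscr{L}(A)$ denotes the bounded linear operators on $A$. A bounded operator $S \in \mathscr{L}(A)$ on a unital $\mathrm{C}^*$-algebra $A$ is a Markov--Schwarz operator if (i) it is unital, i.e., $S\mathbf{1} = \mathbf{1}$, and (ii) it satisfies the Schwarz inequality $(Sx)^* Sx \leq S(x^*x)$ for all $x \in A$. $\mathrm{S}(A) \subset A'$ denotes the set of states on $A$ (positive linear functionals of norm $1$), and $\langle x,\mu\rangle = \mu(x)$ for $x \in A$, $\mu \in A'$. A subnet $(N_i)_{i\in I}$ of $\mathbb{N}$ is a subnet of the sequence $(N)_{N\in\mathbb{N}}$; in particular $I$ is a directed set, $N_i \in \mathbb{N}$, and $N_i \to \infty$ along $I$. For a net $(a_i)_{i\in I}$ of real numbers, $\limsup_i a_i = \inf_{k \in I} \sup_{i \geq k} a_i$. *)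

(* Defs.v *)
From HB Require Import structures.
From mathcomp Require Import all_boot all_order all_algebra.
From mathcomp Require Import complex.
From mathcomp Require Import all_classical all_reals all_analysis.

Set Implicit Arguments.
Unset Strict Implicit.
Unset Printing Implicit Defensive.

Import Order.TTheory GRing.Theory Num.Theory.
Import numFieldNormedType.Exports.

Local Open Scope classical_set_scope.
Local Open Scope ring_scope.
Local Open Scope complex_scope.

Reserved Notation "x *c y" (at level 40, left associativity).

(* The product and the unit are fields of the mixin, not a ring structure on A:
   Hierarchy Builder rejects a new join of normed modules and rings, because
   Num.NumDomain already inherits from both.
   The zero algebra (cstar_one = 0) is allowed. *)
HB.mixin Record isUnitalCStarAlgebra (R : realType) A
    of CompleteNormedModule R[i] A := {
  cstar_mul : A -> A -> A ;
  cstar_one : A ;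
  star : A -> A ;
  cstar_mulA : associative cstar_mul ;
  cstar_mul1r : left_id cstar_one cstar_mul ;
  cstar_mulr1 : right_id cstar_one cstar_mul ;
  cstar_mulDl : left_distributive cstar_mul +%R ;
  cstar_mulDr : right_distributive cstar_mul +%R ;
  cstar_scalerAl : forall (a : R[i]) (x y : A),
    a *: cstar_mul x y = cstar_mul (a *: x) y ;
  cstar_scalerAr : forall (a : R[i]) (x y : A),
    a *: cstar_mul x y = cstar_mul x (a *: y) ;
  cstar_normM : forall x y : A, `|cstar_mul x y| <= `|x| * `|y| ;
  starK : involutive star ;
  starD : {morph star : x y / x + y} ;
  starZ : forall (a : R[i]) (x : A), star (a *: x) = (a^* )%R *: star x ;
  starM : forall x y : A, star (cstar_mul x y) = cstar_mul (star y) (star x) ;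
  cstar_identity : forall x : A, `|cstar_mul (star x) x| = `|x| ^+ 2
}.

#[short(type="unitalCStarAlgType")]
HB.structure Definition UnitalCStarAlgebra (R : realType) :=
  {A of isUnitalCStarAlgebra R A & CompleteNormedModule R[i] A}.

Notation "x *c y" := (cstar_mul x y) : ring_scope.

Definition cstar_pos (R : realType) (A : unitalCStarAlgType R) (x : A) : Prop :=
  exists y : A, x = star y *c y.

Definition cstar_le (R : realType) (A : unitalCStarAlgType R) (x y : A) : Prop :=
  cstar_pos (y - x).

Definition bounded_operator (R : realType) (A : unitalCStarAlgType R)
    (S : {linear A -> A}) : Prop :=
  exists M : R, forall x : A, `|S x| <= M%:C * `|x|.

Record markov_schwarz (R : realType) (A : unitalCStarAlgType R)
    (S : {linear A -> A}) : Prop := MarkovSchwarz {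
  markov_schwarz_bounded : bounded_operator S ;
  markov_schwarz_unital : S cstar_one = cstar_one ;
  markov_schwarz_ineq : forall x : A,
    cstar_le (star (S x) *c S x) (S (star x *c x))
}.

(* The norm of R[i] takes its values in R[i]; this is its real version. *)
Definition cabs (R : realType) (z : R[i]) : R := complex.Re `|z|.

(* Extended-real valued: equal to +oo when mu is unbounded. *)
Definition functional_norm (R : realType) (A : unitalCStarAlgType R)
    (mu : {scalar A}) : \bar R :=
  ereal_sup [set (cabs (mu x))%:E | x in [set x : A | `|x| <= 1]].

(* In R[i], 0 <= z means that z is real and nonnegative. *)
Record is_state (R : realType) (A : unitalCStarAlgType R)
    (mu : {scalar A}) : Prop := IsState {
  state_pos : forall x : A, cstar_pos x -> 0 <= mu x ;
  state_norm1 : functional_norm mu = 1%E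
}.

Record directed (d : Order.disp_t) (I : preorderType d) : Prop := Directed {
  directed_inhabited : inhabited I ;
  directed_ub : forall i j : I, exists k : I, (i <= k)%O /\ (j <= k)%O
}.

(* N : I -> nat is a subnet (in the sense of Kelley) of the sequence 1, 2, 3... *)
Record nat_subnet (d : Order.disp_t) (I : preorderType d) (N : I -> nat) :
    Prop := NatSubnet {
  nat_subnet_directed : directed I ;
  nat_subnet_pos : forall i : I, (0 < N i)%N ;
  nat_subnet_cofinal : forall m : nat, exists k : I,
    forall i : I, (k <= i)%O -> (m <= N i)%N
}.

Definition net_limsup (R : realType) (d : Order.disp_t) (I : preorderType d)
    (a : I -> R) : \bar R :=
  ereal_inf [set ereal_sup [set (a i)%:E | i in [set i : I | (k <= i)%O]]
            | k in [set: I]].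

(* Main.v *)
Require Import Defs.
From HB Require Import structures.
From mathcomp Require Import all_boot all_order all_algebra.
From mathcomp Require Import complex.
From mathcomp Require Import all_classical all_reals all_analysis.
From mathcomp Require Import ring lra.

(** The averages phi_i y = 1/N_i * sum_(n < N_i) mu_i (S^n y) are unital positive
    functionals, and phi_i (S y) - phi_i y telescopes to a quantity of size
    2 |y| / N_i.  Given a real r below the left-hand limsup, the indices i with
    r < |phi_i x|^2 are cofinal, so some ultrafilter G contains all tails of the
    net and this set of indices.  Along G the bounded families Re (phi_i y)
    converge ([ultra_bounded_cvg]), which gives the real part psi of an
    S-invariant unital positive functional phi with r <= |phi x|^2.  Since G
    contains the tails, Re (phi ((S^j x)^* x)) is at most the j-th limsup on the
    right-hand side, and it remains to bound the Cesaro liminf of these numbers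
    below by |phi x|^2.

    The real form B u v = psi (u^* v) is symmetric and positive semidefinite, and
    the Schwarz inequality together with invariance says that S contracts it:
    B (S v) (S v) <= B v v.  The statement is now a mean ergodic theorem.  In the
    Hilbert space of B the averages w_J = 1/J * sum_(1 <= j <= J) S^j x tend to
    the projection p of x on the fixed space, so B w_J x tends to B p p, which is
    at least |phi p|^2 = |phi x|^2 by the Cauchy-Schwarz inequality against the
    unit.  [orbit_average_form_ge] proves the inequality needed here without
    completing the space: every vector v that can be reached from x by S and
    convex combinations satisfies B w_J v - B w_J x -> 0, and if B w_J x stayed
    below the infimum of B v v for infinitely many J, then mixing a little of w_J
    into v would lower B v v by a fixed amount again and again.

    A positive functional f with f 1 = 1 satisfies |f y| <= |y| as soon as it is
    bounded: iterate |f y|^2 <= f (y^* y) and the C*-identity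
    ([unital_positive_of_bounded]).  As S is bounded, this bounds all f \o S^n at
    once by the same constant 1.  That f \o S is again positive is read off the
    Schwarz inequality, which writes S (y^* y) as a sum of two elements z^* z. *)

Set Implicit Arguments.
Unset Strict Implicit.
Unset Printing Implicit Defensive.

Import Order.TTheory GRing.Theory Num.Theory.
Import numFieldNormedType.Exports.

Local Open Scope classical_set_scope.
Local Open Scope ring_scope.
Local Open Scope complex_scope.

(** * Contractions of positive semidefinite real forms *)

(** Real forms on a complex space: for a complex semi-inner product this is its
    real part, and one real limit then replaces a complex one. *)
Record real_psd_form (R : realType) (V : lmodType R[i]) (B : V -> V -> R) :
    Prop := RealPsdForm {
  form_sym : forall u v, B u v = B v u ;
  form_addr : forall u v w, B u (v + w) = B u v + B u w ;
  form_scaler : forall (r : R) u v, B u (r%:C *: v) = r * B u v ;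
  form_ge0 : forall v, 0 <= B v v
}.

Section RealPsdForm.
Variables (R : realType) (V : lmodType R[i]) (B : V -> V -> R).
Hypothesis hB : real_psd_form B.

Lemma form_addl u v w : B (u + v) w = B u w + B v w.
Proof. by rewrite form_sym // form_addr // !(form_sym hB w). Qed.

Lemma form_scalel (r : R) u v : B (r%:C *: u) v = r * B u v.
Proof. by rewrite form_sym // form_scaler // (form_sym hB v). Qed.

Lemma form_suml (X : Type) (s : seq X) (F : X -> V) w :
  B (\sum_(j <- s) F j) w = \sum_(j <- s) B (F j) w.
Proof.
apply: (big_morph (fun v => B v w)) => [u v|]; first exact: form_addl.
by rewrite -(mul0r (B 0 w)) -form_scalel scale0r.
Qed.

Lemma form_oppr u v : B u (- v) = - B u v.
Proof.
have -> : - v = (- 1)%:C *: v by rewrite rmorphN1 scaleN1r.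
by rewrite form_scaler // mulN1r.
Qed.

Lemma form_oppl u v : B (- u) v = - B u v.
Proof. by rewrite form_sym // form_oppr (form_sym hB v). Qed.

Lemma form_subr u v w : B u (v - w) = B u v - B u w.
Proof. by rewrite form_addr // form_oppr. Qed.

Lemma form_subl u v w : B (u - v) w = B u w - B v w.
Proof. by rewrite form_addl form_oppl. Qed.

Lemma form_combination (s t : R) u v :
  B (s%:C *: u + t%:C *: v) (s%:C *: u + t%:C *: v) =
    s ^+ 2 * B u u + 2 * s * t * B u v + t ^+ 2 * B v v.
Proof.
rewrite form_addl !form_addr // !form_scalel !form_scaler // (form_sym hB v u).
by ring.
Qed.

(** Positivity on s u + t v is used at (c, - b) and (- b, a), whichever of
    a = B u u and c = B v v is positive, so that no division is needed; when both
    vanish, u - b v already forces b = 0. *)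
Lemma form_cauchy_schwarz u v : B u v ^+ 2 <= B u u * B v v.
Proof.
have combo s t : 0 <= s ^+ 2 * B u u + 2 * s * t * B u v + t ^+ 2 * B v v.
  by rewrite -form_combination form_ge0.
have := form_ge0 hB u; have := form_ge0 hB v.
move: (B u u) (B u v) (B v v) combo => a b c combo c0 a0.
have [c_gt0|c_le0] := ltP 0 c; first by have := combo c (- b); nra.
have [a_gt0|a_le0] := ltP 0 a; first by have := combo (- b) a; nra.
by have := combo 1 (- b); nra.
Qed.

(** The parallelogram law replaces the triangle inequality, so that seminorms
    only occur squared. *)
Lemma form_scaled_sub_le (r : R) u v :
  B (r%:C *: (u - v)) (r%:C *: (u - v)) <= 2 * r ^+ 2 * (B u u + B v v).
Proof.
have := form_ge0 hB (r%:C *: (u + v)).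
rewrite !(form_scalel, form_scaler hB) form_addl form_subl !form_addr //.
rewrite !form_oppr (form_sym hB v u); nra.
Qed.

End RealPsdForm.

Section Ergodic.
Variables (R : realType) (V : lmodType R[i]) (B : V -> V -> R).
Variable (T : {linear V -> V}).
Hypotheses (hB : real_psd_form B) (hT : forall v, B (T v) (T v) <= B v v).

Definition convex_pred (P : V -> Prop) := forall (t : R) u v,
  0 <= t <= 1 -> P u -> P v -> P ((1 - t)%:C *: u + t%:C *: v).

Definition orbit_average (x : V) (J : nat) : V :=
  (J%:R^-1)%:C *: \sum_(1 <= j < J.+1) iter j T x.

(** The recursion w_(J+1) = J/(J+1) w_J + 1/(J+1) T^(J+1) x keeps the averages in
    every convex T-invariant set that contains x.  The average over no terms is 0
    and need not belong to it, hence J.+1. *)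
Lemma orbit_average_mem (P : V -> Prop) x J : convex_pred P ->
  (forall v, P v -> P (T v)) -> P x -> P (orbit_average x J.+1).
Proof.
move=> cP TP Px; have itP j : P (iter j T x) by elim: j => //= j; exact: TP.
elim: J => [|J IH].
  by rewrite /orbit_average big_nat1 invr1 scale1r; exact: itP 1%N.
have -> : orbit_average x J.+2 =
    (1 - J.+2%:R^-1)%:C *: orbit_average x J.+1 +
    (J.+2%:R^-1)%:C *: iter J.+2 T x.
  rewrite /orbit_average [in LHS]big_nat_recr //= scalerDr scalerA -rmorphM.
  congr (_%:C *: _ + _).
  have : 0 < J.+1%:R :> R by rewrite ltr0n.
  rewrite -[J.+2%:R]natr1; move: (J.+1%:R) => n n_gt0.
  by field; apply/andP; split; lra.
apply: cP => //; rewrite invr_ge0 ler0n /=.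
by rewrite invf_le1 ?ler1n ?ltr0n.
Qed.

(** Contractivity is the positivity of this form, which measures how far T is
    from an isometry.  Its Cauchy-Schwarz inequality does the work of the
    Hilbert space fact that a contraction and its adjoint have the same fixed
    vectors. *)
Lemma defect_form : real_psd_form (fun u v => B u v - B (T u) (T v)).
Proof.
split=> [u v|u v w|r u v|v].
- by rewrite form_sym // [in RHS](form_sym hB v) (form_sym hB (T u)) form_sym.
- by rewrite linearD !form_addr //; ring.
- by rewrite linearZ /= !form_scaler //; ring.
- by rewrite subr_ge0.
Qed.

Lemma form_iter_le x j : B (iter j T x) (iter j T x) <= B x x.
Proof. by elim: j => //= j; apply: le_trans. Qed.

Lemma orbit_average_increment x J :
  T (orbit_average x J) - orbit_average x J =
  (J%:R^-1)%:C *: (iter J.+1 T x - T x).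
Proof.
rewrite /orbit_average linearZ -scalerBr; congr (_ *: _).
rewrite raddf_sum /= -sumrB.
under eq_bigr => j _ do rewrite -iterS.
by rewrite telescope_sumr.
Qed.

Lemma ball_convex Q : convex_pred (fun v => B v v <= Q).
Proof.
move=> t u v /andP[t0 t1] uQ vQ; rewrite form_combination //.
have := form_ge0 hB (1%:C *: u + (-1)%:C *: v).
rewrite form_combination //; move: (B u u) (B u v) (B v v) uQ vQ => a b c aQ cQ.
move=> uv_ge0; have : 0 <= t * (1 - t) * (a - 2 * b + c).
  by rewrite !mulr_ge0 ?subr_ge0 //; lra.
have : (1 - t) * a <= (1 - t) * Q by rewrite ler_wpM2l ?subr_ge0.
have : t * c <= t * Q by rewrite ler_wpM2l.
lra.
Qed.

(** B w (v - T v) is the defect form at w and v plus B (T w - w) (T v).  Both terms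
    are small because T w - w is of size 1/J: for the second this is immediate,
    and the defect of w is - B (T w - w) (T w + w), of size 1/J as well, so that
    Cauchy-Schwarz for the defect form leaves 1/J for the square. *)
Lemma orbit_average_almost_invariant x v J : B v v <= B x x ->
  B (orbit_average x J.+1) (v - T v) ^+ 2 <= 16 * B x x ^+ 2 * J.+1%:R^-1.
Proof.
set Q := B x x; set w := orbit_average x J.+1 => vQ.
have wQ : B w w <= Q.
  apply: (@orbit_average_mem (fun v => B v v <= Q)) => //.
  - exact: ball_convex.
  - by move=> u; exact/le_trans/hT.
set r := J.+1%:R^-1 : R.
have r0 : 0 < r by rewrite invr_gt0 ltr0n.
have r1 : r <= 1 by rewrite invf_le1 ?ler1n ?ltr0n.
set z := T w - w.
have zQ : B z z <= 4 * r ^+ 2 * Q.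
  rewrite /z orbit_average_increment (le_trans (form_scaled_sub_le hB _ _ _)) //.
  have -> : 4 * r ^+ 2 * Q = 2 * r ^+ 2 * (Q + Q) by ring.
  rewrite ler_wpM2l ?mulr_ge0 ?sqr_ge0 // lerD //.
  exact: form_iter_le x J.+2.
have Q0 : 0 <= Q by exact: form_ge0.
have TwQ := le_trans (hT w) wQ.
have TvQ := le_trans (hT v) vQ.
have defect_w : B w w - B (T w) (T w) <= 4 * Q * r.
  have -> : B w w - B (T w) (T w) = - B z (T w + w).
    by rewrite /z form_subl // !form_addr // (form_sym hB w (T w)); ring.
  have sQ : B (T w + w) (T w + w) <= 4 * Q.
    have := form_ge0 hB (T w - w).
    rewrite !(form_subl hB) !(form_subr hB) !(form_addl hB) !(form_addr hB).
    rewrite (form_sym hB w (T w)); lra.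
  have := form_cauchy_schwarz hB z (T w + w).
  have := form_ge0 hB z; have := form_ge0 hB (T w + w).
  move: (B z (T w + w)) (B z z) zQ (B (T w + w) (T w + w)) sQ => b c cQ a aQ a0 c0 bac.
  have : b ^+ 2 <= (4 * Q * r) ^+ 2.
    by rewrite (le_trans bac)// (le_trans (ler_pM _ _ cQ aQ)) //; nra.
  move=> b2.
  have : `|b| <= 4 * Q * r.
    by rewrite -ler_sqr ?nnegrE ?real_normK ?num_real // !mulr_ge0 // ltW.
  by rewrite ler_norml => /andP[+ _]; lra.
have -> : B w (v - T v) = (B w v - B (T w) (T v)) + B z (T v).
  by rewrite /z form_subr // form_subl //; ring.
have := form_cauchy_schwarz defect_form w v => /=.
have := form_cauchy_schwarz hB z (T v).
have := form_ge0 defect_form w => /=; have := form_ge0 defect_form v => /=.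
have := form_ge0 hB z; have := form_ge0 hB (T v).
move: (B w v - B (T w) (T v)) (B z (T v)) => b c h1 h2 h3 h4 hc hb.
have b2 : b ^+ 2 <= 4 * Q ^+ 2 * r.
  apply: (le_trans hb); apply: (@le_trans _ _ (4 * Q * r * Q)); last by lra.
  apply: ler_pM => //; lra.
have c2 : c ^+ 2 <= 4 * Q ^+ 2 * r.
  apply: (le_trans hc); apply: (@le_trans _ _ (4 * r ^+ 2 * Q * Q)).
    by apply: ler_pM.
  have : 0 <= Q ^+ 2 * (r * (1 - r)) by rewrite !mulr_ge0 ?sqr_ge0 ?subr_ge0 // ltW.
  by lra.
have : 0 <= (b - c) ^+ 2 by exact: sqr_ge0.
rewrite !expr2 in b2 c2 *; lra.
Qed.

Lemma cvg0_of_sqr_le_harmonic (u : nat -> R) (C : R) :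
  (forall J, u J ^+ 2 <= C * J.+1%:R^-1) -> u @ \oo --> (0 : R).
Proof.
move=> uC; have : (fun J => C * harmonic J) @ \oo --> (0 : R).
  by rewrite -(mulr0 C); apply: cvgMl_tmp; exact: cvg_harmonic.
move=> /cvgr0Pnorm_lt C0; apply/cvgr0Pnorm_lt => e e0.
have := C0 _ (exprn_gt0 2 e0); apply: filterS => J.
move=> /(le_lt_trans (ler_norm _)) /(le_lt_trans (uC J)) uJ.
by rewrite -ltr_sqr ?nnegrE ?real_normK ?num_real // ltW.
Qed.

(** A lower bound q of B v v on a convex T-invariant set containing x is eventually
    almost a lower bound of B w_J x.  The vectors v in P with B v v <= B x x and
    B w_J (v - x) -> 0 form a convex T-invariant set K containing x, hence all w_J.
    If B w_J x < q - e for some large J, then B w_J v < q - e / 2, and moving from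
    v to (1 - t) v + t w_J stays in K and decreases B v v to first order in t.
    As the gain does not depend on v, repeating this makes B v v negative. *)
Lemma orbit_average_form_ge (P : V -> Prop) x (q e : R) :
  convex_pred P -> (forall v, P v -> P (T v)) -> P x ->
  (forall v, P v -> q <= B v v) -> 0 < e ->
  exists n, forall J, (n <= J)%N -> q - e <= B (orbit_average x J) x.
Proof.
move=> cP TP Px Pq e0; set Q := B x x.
have Q0 : 0 <= Q by exact: form_ge0.
pose G v := (fun J => B (orbit_average x J.+1) (v - x)) @ \oo --> (0 : R).
pose K v := [/\ P v, B v v <= Q & G v].
have cK : convex_pred K.
  move=> t u v t01 [Pu uQ Gu] [Pv vQ Gv]; split; first exact: cP.
    exact: ball_convex.
  rewrite /G; under eq_fun => J.
    have -> : (1 - t)%:C *: u + t%:C *: v - x =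
              (1 - t)%:C *: (u - x) + t%:C *: (v - x).
      have t1 : (1 - t)%:C + t%:C = 1 :> R[i].
        by apply/eqP; rewrite eq_complex /= subrK addr0 !eqxx.
      by rewrite !scalerBr addrACA -opprD -scalerDl t1 scale1r.
    rewrite form_addr // !form_scaler //; over.
  have Guv := cvgD (cvgMl_tmp (a := 1 - t) Gu) (cvgMl_tmp (a := t) Gv).
  by rewrite !mulr0 addr0 in Guv; exact: Guv.
have TK v : K v -> K (T v).
  move=> [Pv vQ Gv]; split; [exact: TP|exact: le_trans (hT v) vQ|].
  rewrite /G; under eq_fun => J.
    have -> : T v - x = (v - x) - (v - T v) by rewrite opprB [RHS]addrC addrA subrK.
    rewrite form_subr //; over.
  rewrite -[0]subr0; apply: cvgB => //.
  by apply: cvg0_of_sqr_le_harmonic => J; apply: orbit_average_almost_invariant.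
have Kx : K x.
  split=> //; rewrite /G subrr; under eq_fun => J.
    rewrite -(subrr x) form_subr // subrr; over.
  exact: cvg_cst.
have Kw J : K (orbit_average x J.+1) by exact: orbit_average_mem.
apply: contrapT => /forallNP often.
(* A step t changes B v v by at most - t e + t^2 (e + Q), which is minimal here,
   with value - t e / 2. *)
pose t := e / (2 * (e + Q)).
have t0 : 0 < t by rewrite divr_gt0 // mulr_gt0 //; lra.
have tQ : t * (e + Q) = e / 2 by rewrite /t; field; lra.
have t1 : t <= 1 by rewrite ler_pdivrMr; lra.
clearbody t.
have step v : K v -> exists2 v', K v' & B v' v' <= B v v - t * e / 2.
  move=> Kv; have [Pv vQ Gv] := Kv.
  have /cvgr0Pnorm_lt/(_ (e / 2)) := Gv; case; first by lra.
  move=> m _ hm; have /existsNP[[|J] /not_implyP[mJ]] := often m.+1; first by [].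
  move=> /negP; rewrite -ltNge => wx.
  have := hm J mJ; rewrite /= form_subr // ltr_norml => /andP[_ wv].
  set w := orbit_average x J.+1 in wx wv.
  exists ((1 - t)%:C *: v + t%:C *: w).
    by apply: cK; [rewrite t1 ltW|exact: Kv|exact: Kw].
  have [_ wQ _] := Kw J; rewrite -/w in wQ.
  rewrite form_combination // (form_sym hB v w).
  have qv := Pq v Pv; have v0 := form_ge0 hB v.
  move: (B v v) (B w v) (B w w) qv v0 wv wQ => b d c qb b0 dx cQ.
  have : (1 - t) * t * d <= (1 - t) * t * (b - e / 2).
    rewrite ler_wpM2l //; last by lra.
    by rewrite mulr_ge0 ?subr_ge0 // ltW.
  have : t ^+ 2 * c <= t ^+ 2 * Q by rewrite ler_wpM2l ?sqr_ge0.
  have : 0 <= t ^+ 2 * b by rewrite mulr_ge0 ?sqr_ge0.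
  have : t * (t * (e + Q)) = t * (e / 2) by rewrite tQ.
  lra.
have descent k : exists2 v, K v & B v v <= Q - k%:R * (t * e / 2).
  elim: k => [|k [v Kv vk]]; first by exists x; rewrite ?mul0r ?subr0.
  have [v' Kv' v'v] := step v Kv; exists v' => //.
  rewrite -natr1 mulrDl mul1r; lra.
have [v _] := descent (Num.truncn (Q / (t * e / 2))).+1.
have := form_ge0 hB v; have := truncnS_gt (Q / (t * e / 2)).
rewrite ltr_pdivrMr; last by rewrite divr_gt0 // mulr_gt0.
lra.
Qed.
End Ergodic.

(** * Positive functionals and Markov-Schwarz operators *)

Section Powers.
Variable R : realType.

Lemma exists_pow_gt (a C : R) : 1 < a -> exists n, C < a ^+ (2 ^ n).
Proof.
move=> a1.
have bernoulli n : n%:R * (a - 1) <= a ^+ n.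
  elim: n => [|n IH]; first by rewrite mul0r expr0.
  have : 1 <= a ^+ n by rewrite exprn_ege1 // ltW.
  rewrite -natr1 exprS; nra.
exists (Num.truncn (C / (a - 1))).+1.
set n := (Num.truncn _).+1; have n2 : (n <= 2 ^ n)%N by rewrite ltnW // ltn_expl.
apply: lt_le_trans (_ : a ^+ n <= _); last first.
  by apply: ler_weXn2l; [exact: ltW|exact: n2].
apply: lt_le_trans (bernoulli n); rewrite -ltr_pdivrMr ?subr_gt0 //.
exact: truncnS_gt.
Qed.

Lemma le_of_pow_le (a b C : R) : 0 <= a -> 0 <= b ->
  (forall n, a ^+ (2 ^ n) <= C * b ^+ (2 ^ n)) -> a <= b.
Proof.
move=> a0 b0 abC; rewrite leNgt; apply/negP => ba.
have [bgt0|] := ltP 0 b; last first.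
  move=> b_le0; have b_eq0 : b = 0 by lra.
  by have := abC 0; rewrite expn0 !expr1 b_eq0 mulr0; lra.
have ab1 : 1 < a / b by rewrite ltr_pdivlMr ?mul1r.
have [n] := exists_pow_gt C ab1.
by rewrite exprMn exprVn ltr_pdivlMr ?exprn_gt0 // ltNge abC.
Qed.
End Powers.

Section PositiveFunctional.
Variables (R : realType) (A : unitalCStarAlgType R).
Implicit Types (f : A -> R[i]) (x y : A).

Lemma star_one : star cstar_one = cstar_one :> A.
Proof. by rewrite -[LHS]cstar_mul1r -[X in X *c _]starK -starM cstar_mul1r starK. Qed.

(** The unit is a projection, so its norm is its own square; it is 0 in the zero
    algebra. *)
Lemma cstar_norm1 : `|cstar_one : A| <= 1.
Proof.
have := cstar_identity (cstar_one : A); rewrite star_one cstar_mul1r expr2.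
have [->|n0] := eqVneq `|cstar_one : A| 0; first by [].
by rewrite -{1}[`|_|]mulr1 => /(mulfI n0) <-.
Qed.

(** Positive elements enter only through the squares y^* y, so that the Schwarz
    inequality for S turns directly into positivity of f \o S. *)
Record positive_functional f : Prop := PositiveFunctional {
  positive_scalar : scalar f ;
  positive_ge0 : forall y, 0 <= f (star y *c y)
}.

Section Basics.
Variable f : A -> R[i].
Hypothesis hf : positive_functional f.

Lemma positiveD u v : f (u + v) = f u + f v.
Proof. by rewrite -{1}[u]scale1r positive_scalar // mul1r. Qed.

Lemma positive0 : f 0 = 0.
Proof. by apply: (addrI (f 0)); rewrite -positiveD !addr0. Qed.

Lemma positiveZ a u : f (a *: u) = a * f u.
Proof. by rewrite -[a *: u]addr0 positive_scalar // positive0 addr0. Qed.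

Lemma positiveB u v : f (u - v) = f u - f v.
Proof. by rewrite positiveD -scaleN1r positiveZ mulN1r. Qed.

Lemma positive_shift c y :
  f (star (y + c *: cstar_one) *c (y + c *: cstar_one)) =
  f (star y *c y) + (c * f (star y) + (c^* )%R * f y) + `|c| ^+ 2 * f cstar_one.
Proof.
rewrite starD starZ star_one cstar_mulDl !cstar_mulDr.
rewrite -!cstar_scalerAl -!cstar_scalerAr !cstar_mul1r !cstar_mulr1.
rewrite !positiveD !positiveZ normCK; ring.
Qed.

Lemma Im_add (u v : R[i]) : complex.Im (u + v) = complex.Im u + complex.Im v.
Proof. by case: u v => [a b] [c d]. Qed.

(** Positivity at y + c 1 makes c f (star y) + conj c * f y real for every c; the values
    c = 1 and c = i determine f (star y). *)
Lemma positive_star y : f (star y) = ((f y)^* )%R.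
Proof.
have Im_cross c : complex.Im (c * f (star y) + (c^* )%R * f y) = 0.
  have f1 : 0 <= f cstar_one.
    by have := positive_ge0 hf cstar_one; rewrite star_one cstar_mul1r.
  have := ger0_Im (positive_ge0 hf (y + c *: cstar_one)).
  rewrite positive_shift !Im_add (ger0_Im (positive_ge0 hf y)).
  by rewrite (ger0_Im (mulr_ge0 (exprn_ge0 2 (normr_ge0 c)) f1)) add0r addr0.
have := Im_cross 1; have := Im_cross 'i%C.
case: (f y) (f (star y)) => [a b] [c d] /=.
rewrite !mul0r !mul1r mulN1r oppr0 !add0r addr0 => h1 h2.
by apply/eqP; rewrite eq_complex /=; apply/andP; split; apply/eqP; lra.
Qed.

(** Positivity at y - f y 1.  For f 1 = 1 this is the Cauchy-Schwarz inequality
    against the unit; the form with f 1 lets one compare f 1 with the norm of f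
    before f 1 is known. *)
Lemma positive_sqr_norm y : `|f y| ^+ 2 * (2 - f cstar_one) <= f (star y *c y).
Proof.
have := positive_ge0 hf (y - f y *: cstar_one).
rewrite -scaleNr positive_shift positive_star rmorphN /= normrN normCK.
set a := f y; set b := (a^* )%R => h; rewrite -subr_ge0 (le_trans h) //.
by rewrite le_eqVlt; apply/orP; left; apply/eqP; ring.
Qed.
End Basics.

Record unital_positive f : Prop := UnitalPositive {
  unital_positive_functional : positive_functional f ;
  unital_positive1 : f cstar_one = 1 ;
  unital_positive_le : forall y, `|f y| <= `|y|
}.

Lemma unital_positive_sqr_norm f y : positive_functional f -> f cstar_one = 1 ->
  `|f y| ^+ 2 <= f (star y *c y).
Proof.
move=> hf f1; have := positive_sqr_norm hf y.
by rewrite f1 (_ : 2 - 1 = 1) ?mulr1 //; ring.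
Qed.

(** Any bound can be improved to 1.  With h_0 = y and h_(n+1) = h_n^* h_n, the
    Cauchy-Schwarz inequality gives |f y|^(2^n) <= |f h_n|, and the C*-identity
    |h_n| = |y|^(2^n); hence |f y|^(2^n) <= C |y|^(2^n) for all n. *)
Lemma unital_positive_of_bounded f (C : R) : positive_functional f ->
  f cstar_one = 1 -> (forall y, `|f y| <= C%:C * `|y|) -> unital_positive f.
Proof.
move=> hf f1 fC; split=> // y.
pose g n := iter n (fun h => star h *c h) y.
have norm_g n : `|g n| = `|y| ^+ (2 ^ n).
  by elim: n => [|n IH] //=; rewrite cstar_identity IH -exprM expnSr.
have f_g n : `|f y| ^+ (2 ^ n) <= `|f (g n)|.
  elim: n => [|n IH] //=; rewrite expnSr exprM.
  apply: le_trans (_ : `|f (g n)| ^+ 2 <= _).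
    by rewrite ler_pXn2r ?nnegrE ?exprn_ge0.
  rewrite (le_trans (unital_positive_sqr_norm _ hf f1)) //.
  by rewrite ger0_norm // positive_ge0.
have [a0 b0] : 0 <= `|f y| /\ 0 <= `|y| by [].
have {}fC n : `|f y| ^+ (2 ^ n) <= C%:C * `|y| ^+ (2 ^ n).
  by rewrite -norm_g (le_trans (f_g n)).
move: fC; rewrite -(RRe_real (ger0_real a0)) -(RRe_real (ger0_real b0)) lecR => fC.
apply: (@le_of_pow_le _ _ _ C).
- by rewrite -ler0c RRe_real ?ger0_real.
- by rewrite -ler0c RRe_real ?ger0_real.
- by move=> n; rewrite -lecR rmorphM !rmorphXn.
Qed.

(** If s = mu 1 were less than 1, then |mu y|^2 (2 - s) <= mu (y^* y) <= 1 on the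
    unit ball would bound the norm of mu by (2 - s)^(-1/2) < 1. *)
Lemma state_unital_positive (mu : {scalar A}) : is_state mu -> unital_positive mu.
Proof.
move=> [mu_pos mu_norm].
have hmu : positive_functional mu.
  by split=> [|y]; [exact: linearP|apply: mu_pos; exists y].
have mu_le1 y : `|y| <= 1 -> `|mu y| <= 1.
  move=> y1; have : ((cabs (mu y))%:E <= 1)%E.
    by rewrite -mu_norm; apply: ereal_sup_ubound; exists y.
  by rewrite lee_fin -lecR /cabs RRe_real ?ger0_real.
have mu_le y : `|mu y| <= 1%:C * `|y|.
  rewrite mul1r; have [->|y0] := eqVneq y 0; first by rewrite linear0 !normr0.
  have ny0 : 0 < `|y| by rewrite normr_gt0.
  have := mu_le1 (`|y|^-1 *: y); rewrite normrZ normfV normr_id mulVf ?gt_eqF //.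
  by move=> /(_ (lexx _)); rewrite linearZ normrM normfV normr_id ler_pdivrMl // mulr1.
suff mu1 : mu cstar_one = 1 by exact: unital_positive_of_bounded mu_le.
have mu1_ge0 : 0 <= mu cstar_one.
  by have := positive_ge0 hmu cstar_one; rewrite star_one cstar_mul1r.
have mu1_le : mu cstar_one <= 1.
  by rewrite -(ger0_norm mu1_ge0) mu_le1 // cstar_norm1.
apply/le_anti; rewrite mu1_le andTb.
have s_eq := esym (RRe_real (ger0_real mu1_ge0)).
set s := complex.Re _ in s_eq; rewrite s_eq in mu1_le *.
rewrite !lecR in mu1_le *.
rewrite leNgt; apply/negP => s_lt1.
have : (functional_norm mu <= (Num.sqrt (2 - s)^-1)%:E)%E.
  apply: ge_ereal_sup => _ [y /= y1 <-]; rewrite lee_fin.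
  set a := cabs (mu y).
  have aE : `|mu y| = a%:C by rewrite RRe_real ?ger0_real.
  have a0 : 0 <= a by rewrite -ler0c -aE.
  rewrite -[a]ger0_norm // -sqrtr_sqr ler_wsqrtr // -[leRHS]mul1r.
  rewrite ler_pdivlMr; last by lra.
  have := positive_sqr_norm hmu y; rewrite s_eq aE => h.
  have {}h : (a ^+ 2 * (2 - s))%:C <= 1.
    rewrite rmorphM rmorphXn rmorphB rmorph_nat (le_trans h) //.
    rewrite -[leLHS]ger0_norm ?positive_ge0 // mu_le1 // cstar_identity.
    by rewrite exprn_ile1.
  by rewrite -lecR.
rewrite mu_norm lee_fin -{1}sqrtr1 ler_sqrt; last by rewrite invr_ge0; lra.
by rewrite invf_ge1; lra.
Qed.

(** The Schwarz inequality reads S (y^* y) = z^* z + (S y)^* S y, so f \o S is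
    positive; it is bounded by any bound of S, hence by 1. *)
Lemma unital_positive_comp f (S : {linear A -> A}) : markov_schwarz S ->
  unital_positive f -> unital_positive (f \o S).
Proof.
move=> [[M SM] S1 schwarz] [hf f1 fle].
have hfS : positive_functional (f \o S).
  split=> [a u v|y] /=; first by rewrite linearP positive_scalar.
  have [z Sz] := schwarz y.
  rewrite -(subrK (star (S y) *c S y) (S _)) Sz positiveD //.
  by rewrite addr_ge0 ?positive_ge0.
apply: (@unital_positive_of_bounded _ M) => //=; first by rewrite S1.
by move=> y; rewrite (le_trans (fle _)).
Qed.

Lemma unital_positive_iter f (S : {linear A -> A}) n : markov_schwarz S ->
  unital_positive f -> unital_positive (fun y => f (iter n S y)).
Proof.
move=> hS hf; elim: n => [|n IH]; first exact: hf.
rewrite (_ : (fun y => _) = (fun y => f (iter n S y)) \o S).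
  exact: unital_positive_comp.
by apply/funext => y; rewrite iterSr.
Qed.

Lemma unital_positive_mean (f_ : nat -> A -> R[i]) N : (0 < N)%N ->
  (forall n, unital_positive (f_ n)) ->
  unital_positive (fun y => N%:R^-1 * \sum_(0 <= n < N) f_ n y).
Proof.
move=> N0 hf; have N_ne0 : N%:R != 0 :> R[i] by rewrite pnatr_eq0 -lt0n.
have hp n := unital_positive_functional (hf n).
split; first split=> [a u v|y].
- under eq_bigr do rewrite positive_scalar //.
  by rewrite big_split /= -mulr_sumr mulrDr mulrCA.
- rewrite mulr_ge0 ?invr_ge0 ?ler0n ?sumr_ge0 // => n _.
  exact/positive_ge0.
- under eq_bigr do rewrite unital_positive1 //.
  by rewrite sumr_const_nat subn0 mulVf.
- move=> y; rewrite normrM ger0_norm ?invr_ge0 ?ler0n // ler_pdivrMl ?ltr0n //.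
  rewrite (le_trans (ler_norm_sum _ _ _)) //.
  rewrite (le_trans (ler_sum _ (fun n _ => unital_positive_le (hf n) y))) //.
  by rewrite sumr_const_nat subn0 mulr_natl.
Qed.
End PositiveFunctional.

(** * Ultrafilters and limits superior of nets *)

Section Ultralimit.
Variables (R : realType) (I : Type) (G : set_system I).
Hypothesis GU : UltraFilter G.

(** A cluster point p exists by compactness, and it is a limit: if the preimage of
    a neighbourhood of p were not in G, its complement would be. *)
Lemma ultra_bounded_cvg (u : I -> R) (C : R) :
  (forall i, `|u i| <= C) -> cvg (u @ G).
Proof.
move=> uC; have [p [_ p_cluster]] : `[- C, C]%classic `&` cluster (u @ G) !=set0.
  apply: segment_compact.
  suff : G (u @^-1` `[- C, C]) by [].
  by apply: filterE => i; rewrite /= in_itv /= -ler_norml.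
apply/cvg_ex; exists p => W pW.
have [//|uW] := in_ultra_setVsetC (u @^-1` W) GU.
by have [z []] := p_cluster (~` W) W uW pW.
Qed.

Lemma le_limits (f g : I -> R) (l l' : R) : f @ G --> l -> g @ G --> l' ->
  (forall i, f i <= g i) -> l <= l'.
Proof.
move=> fl gl fg; rewrite -subr_ge0; apply: (cvgr_to_ge (cvgB gl fl)).
by apply: filterE => i; rewrite /= subr_ge0.
Qed.
End Ultralimit.

Lemma le_ereal_of_lt_fin (R : realType) (x y : \bar R) :
  (forall r : R, (r%:E < x)%E -> (r%:E <= y)%E) -> (x <= y)%E.
Proof.
case: x => [s| |] xy; last 2 first.
- case: y xy => [t| |] xy //; last by have := xy 0 (ltry _).
  by have := xy (t + 1) (ltry _); rewrite lee_fin leNgt ltrDl ltr01.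
- exact: leNye.
apply/lee_subgt0Pr => e e0; rewrite -EFinB; apply: xy.
by rewrite lte_fin gtrBl.
Qed.

Section NetLimsup.
Variables (R : realType) (d : Order.disp_t) (I : preorderType d).
Implicit Types (u : I -> R).

Lemma lt_net_limsup_frequently u (r : R) : (r%:E < net_limsup u)%E ->
  forall k : I, exists2 i, (k <= i)%O & r < u i.
Proof.
move=> ru k; have : (r%:E < ereal_sup [set (u i)%:E | i in [set i : I | (k <= i)%O]])%E.
  by apply: (lt_le_trans ru); apply: ereal_inf_lbound; exists k.
by move=> /ereal_sup_gt[_ [i ki <-]]; exists i.
Qed.

Lemma cvg_le_net_limsup (G : set_system I) u (l : R) : ProperFilter G ->
  (forall k : I, G [set i | (k <= i)%O]) -> u @ G --> l ->
  (l%:E <= net_limsup u)%E.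
Proof.
move=> FG tails ul; apply: le_ereal_inf_tmp => _ [k _ <-].
have sup_ge i : (k <= i)%O ->
    ((u i)%:E <= ereal_sup [set (u i)%:E | i in [set i : I | (k <= i)%O]])%E.
  by move=> ki; apply: ereal_sup_ubound; exists i.
case: ereal_sup sup_ge => [s| |] sup_ge; last 2 first.
- exact: leey.
- by have := sup_ge k (lexx k).
rewrite lee_fin; apply: (cvgr_to_le ul).
by apply: filterS (tails k) => i /sup_ge.
Qed.

(** The sets of the tails intersected with E form a filter base because I is
    directed. *)
Lemma frequently_ultrafilter (E : set I) : directed I ->
  (forall k : I, exists2 i, (k <= i)%O & E i) ->
  exists G : set_system I,
    [/\ UltraFilter G, forall k : I, G [set i | (k <= i)%O] & G E].
Proof.
move=> [[i0] dir] freq; pose tail k := [set i | (k <= i)%O] `&` E.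
have F_proper : ProperFilter (filter_from setT tail).
  apply: filter_from_proper => [|k _]; last first.
    by have [i ki Ei] := freq k; exists i.
  apply: filter_fromT_filter => [|i j]; first by exists i0.
  have [k [ik jk]] := dir i j; exists k => l [kl El].
  by split; split=> //=; apply: le_trans kl.
have [G [GU FG]] := ultraFilterLemma F_proper; exists G; split=> // [k|].
  by apply: FG; exists k => // i [].
by apply: FG; exists i0 => // i [].
Qed.
End NetLimsup.

(** * The limit functional along an ultrafilter *)

Section LimitFunctional.
Variables (R : realType) (A : unitalCStarAlgType R) (S : {linear A -> A}).
Variables (I : Type) (G : set_system I) (phi : I -> A -> R[i]).
Hypotheses (hS : markov_schwarz S) (GU : UltraFilter G).
Hypothesis hphi : forall i, unital_positive (phi i).
Hypothesis phi_invariant : forall y,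
  complex.Re (phi i (S y)) - complex.Re (phi i y) @[i --> G] --> (0 : R).

(** Only the real part is taken to the limit: the imaginary part of f y is minus
    the real part of f (i y). *)
Definition ultralimit_re y : R := lim (complex.Re (phi i y) @[i --> G]).
Local Notation psi := ultralimit_re.

Lemma Re_le_norm (z : R[i]) (M : R) : `|z| <= M%:C -> `|complex.Re z| <= M.
Proof. by move=> zM; rewrite -lecR (le_trans (normc_ge_Re z)). Qed.

Lemma ultralimit_re_cvg y : complex.Re (phi i y) @[i --> G] --> psi y.
Proof.
apply: (@ultra_bounded_cvg _ _ _ _ _ (complex.Re `|y|)) => i.
by apply: Re_le_norm; rewrite RRe_real ?ger0_real // unital_positive_le.
Qed.

Lemma ultralimit_re_unique y (l : R) :
  complex.Re (phi i y) @[i --> G] --> l -> psi y = l.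
Proof. exact: cvg_lim. Qed.

Lemma ultralimit_reD u v : psi (u + v) = psi u + psi v.
Proof.
apply: ultralimit_re_unique.
under eq_fun do rewrite (positiveD (unital_positive_functional (hphi _))).
rewrite (_ : (fun i => _) =
  (fun i => complex.Re (phi i u) + complex.Re (phi i v))); last first.
  by apply/funext => i; case: (phi i u) (phi i v) => [? ?] [].
by apply: cvgD; exact: ultralimit_re_cvg.
Qed.

Lemma ultralimit_reZ (r : R) y : psi (r%:C *: y) = r * psi y.
Proof.
apply: ultralimit_re_unique.
under eq_fun do rewrite (positiveZ (unital_positive_functional (hphi _))).
rewrite (_ : (fun i => _) = (fun i => r * complex.Re (phi i y))); last first.
  by apply/funext => i; case: (phi i y) => a b /=; rewrite mul0r subr0.
by apply: cvgMl_tmp; exact: ultralimit_re_cvg.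
Qed.

Lemma ultralimit_re_star y : psi (star y) = psi y.
Proof.
apply: ultralimit_re_unique.
under eq_fun do rewrite (positive_star (unital_positive_functional (hphi _))).
rewrite (_ : (fun i => _) = (fun i => complex.Re (phi i y))).
  exact: ultralimit_re_cvg.
by apply/funext => i; case: (phi i y).
Qed.

Lemma ultralimit_re_invariant y : psi (S y) = psi y.
Proof.
apply: ultralimit_re_unique; rewrite -[psi y]add0r.
rewrite (_ : (fun i => _) = (fun i => (complex.Re (phi i (S y)) -
    complex.Re (phi i y)) + complex.Re (phi i y))).
  by apply: cvgD; [exact: phi_invariant|exact: ultralimit_re_cvg].
by apply/funext => i; rewrite subrK.
Qed.

Lemma ultralimit_re_le u v : (forall i, complex.Re (phi i u) <= complex.Re (phi i v)) ->
  psi u <= psi v.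
Proof.
by move=> uv; apply: le_limits uv; exact: ultralimit_re_cvg.
Qed.

Lemma ultralimit_form : real_psd_form (fun u v => psi (star u *c v)).
Proof.
split=> [u v|u v w|r u v|v].
- by rewrite -ultralimit_re_star starM starK.
- by rewrite cstar_mulDr ultralimit_reD.
- by rewrite -cstar_scalerAr ultralimit_reZ.
- rewrite -(mul0r (psi v)) -ultralimit_reZ scale0r; apply: ultralimit_re_le => i.
  have hi := unital_positive_functional (hphi i).
  by rewrite (positive0 hi); have := positive_ge0 hi v; rewrite lecE => /andP[].
Qed.

Lemma ultralimit_form_contraction v :
  psi (star (S v) *c S v) <= psi (star v *c v).
Proof.
rewrite -(ultralimit_re_invariant (star v *c v)); apply: ultralimit_re_le => i.
have [z Sz] := markov_schwarz_ineq hS v.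
have hi := unital_positive_functional (hphi i).
have := positive_ge0 hi z; rewrite -Sz (positiveB hi) subr_ge0 lecE.
by move=> /andP[].
Qed.

(** The left-hand side is |phi v|^2 for the limit functional phi, because
    Im (phi v) is minus the real part of phi (i v). *)
Lemma ultralimit_re_sqr_le v :
  psi v ^+ 2 + psi ('i%C *: v) ^+ 2 <= psi (star v *c v).
Proof.
have sqr_cvg y : complex.Re (phi i y) ^+ 2 @[i --> G] --> psi y ^+ 2.
  rewrite expr2; under eq_fun do rewrite expr2.
  by apply: cvgM; exact: ultralimit_re_cvg.
have lhs_cvg : complex.Re (phi i v) ^+ 2 + complex.Re (phi i ('i%C *: v)) ^+ 2
    @[i --> G] --> psi v ^+ 2 + psi ('i%C *: v) ^+ 2.
  by apply: cvgD; exact: sqr_cvg.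
apply: le_limits lhs_cvg _ _; first exact: ultralimit_re_cvg.
move=> i; have [hi hi1 _] := hphi i.
have := unital_positive_sqr_norm v hi hi1.
rewrite (positiveZ hi) -add_Re2_Im2 lecE => /andP[_].
by case: (phi i v) => a b /=; rewrite mul0r mul1r sub0r sqrrN.
Qed.

End LimitFunctional.

(** * Averages of a functional along the iterates of the operator *)

Section Averages.
Variables (R : realType) (A : unitalCStarAlgType R) (S : {linear A -> A}).
Hypothesis hS : markov_schwarz S.

Definition pulled_average (f : A -> R[i]) (N : nat) (y : A) : R[i] :=
  N%:R^-1 * \sum_(0 <= n < N) f (iter n S y).

Lemma pulled_average_unital_positive f N : (0 < N)%N -> unital_positive f ->
  unital_positive (pulled_average f N).
Proof.
by move=> N0 hf; apply: unital_positive_mean => // n; exact: unital_positive_iter.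
Qed.

Lemma pulled_average_increment f N y : (0 < N)%N -> unital_positive f ->
  `|pulled_average f N (S y) - pulled_average f N y| <=
    N%:R^-1 * (2 * `|y|).
Proof.
move=> N0 hf; rewrite /pulled_average -mulrBr -sumrB.
under eq_bigr do rewrite -iterSr.
rewrite telescope_sumr // normrM ger0_norm ?invr_ge0 ?ler0n //.
rewrite ler_wpM2l ?invr_ge0 ?ler0n // (le_trans (ler_normB _ _)) //.
rewrite mulr_natl mulr2n lerD ?(unital_positive_le (unital_positive_iter _ hS hf)) //.
Qed.

Lemma Re_pulled_average f N y :
  complex.Re (pulled_average f N y) =
  N%:R^-1 * \sum_(0 <= n < N) complex.Re (f (iter n S y)).
Proof.
have Re_scale (r : R) z : complex.Re (r%:C * z) = r * complex.Re z.
  by case: z => a b /=; rewrite mul0r subr0.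
have Re_add (z w : R[i]) : complex.Re (z + w) = complex.Re z + complex.Re w.
  by case: z w => [a b] [].
rewrite -(big_morph _ Re_add (erefl : complex.Re 0 = 0)) -Re_scale.
by rewrite fmorphV rmorph_nat.
Qed.

Lemma pulled_average_asymptotically_invariant (d : Order.disp_t)
    (I : preorderType d) (N : I -> nat) (f : I -> A -> R[i])
    (G : set_system I) (FG : Filter G) y :
  nat_subnet N -> (forall i, unital_positive (f i)) ->
  (forall k : I, G [set i | (k <= i)%O]) ->
  complex.Re (pulled_average (f i) (N i) (S y)) -
    complex.Re (pulled_average (f i) (N i) y) @[i --> G] --> (0 : R).
Proof.
move=> hN hf tails; apply/cvgr0Pnorm_lt => e e0.
set M := 2 * complex.Re `|y|.
have [k kN] := nat_subnet_cofinal hN (Num.truncn (M / e)).+1.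
apply: filterS (tails k) => i /= ki.
have N0 := nat_subnet_pos hN i.
have {ki kN} : M / e < (N i)%:R.
  by rewrite (lt_le_trans (truncnS_gt _)) // ler_nat kN.
rewrite ltr_pdivrMr // -ltr_pdivrMl ?ltr0n //; apply: le_lt_trans.
have := pulled_average_increment y N0 (hf i).
have yE : `|y| = (complex.Re `|y|)%:C by rewrite RRe_real ?ger0_real.
rewrite yE => h.
rewrite (_ : _ - _ = complex.Re (pulled_average (f i) (N i) (S y) -
  pulled_average (f i) (N i) y)).
  apply: Re_le_norm; apply: (le_trans h).
  by rewrite /M !rmorphM fmorphV !rmorph_nat.
by case: pulled_average => a b; case: pulled_average.
Qed.

End Averages.

(** * The inequality *)

Theorem theorem3p3 (R : realType) (A : unitalCStarAlgType R)
    (S : {linear A -> A}) (hS : markov_schwarz S) (x : A)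
    (d : Order.disp_t) (I : preorderType d) (N : I -> nat) (hN : nat_subnet N)
    (mu : I -> {scalar A}) (hmu : forall i : I, is_state (mu i)) :
  (net_limsup (fun i : I =>
      (cabs (mu i ((N i)%:R^-1 *: \sum_(0 <= n < N i) iter n S x)) ^+ 2)%R)
   <=
   limn_einf (fun J : nat =>
      (J%:R^-1)%:E * \sum_(1 <= j < J.+1)
        net_limsup (fun i : I =>
          (N i)%:R^-1 * \sum_(0 <= n < N i)
            complex.Re (mu i (iter n S (star (iter j S x) *c x))))%R))%E.
Proof.
pose phi i := pulled_average S (mu i) (N i).
have hmu' i : unital_positive (mu i) by exact: state_unital_positive.
have hphi i : unital_positive (phi i).
  by apply: pulled_average_unital_positive => //; exact: nat_subnet_pos.
rewrite (_ : (fun i => cabs _ ^+ 2) = (fun i =>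
    complex.Re (phi i x) ^+ 2 + complex.Re (phi i ('i%C *: x)) ^+ 2)); last first.
  apply/funext => i; rewrite linearZ raddf_sum /= -/(pulled_average S (mu i) (N i) x).
  rewrite -/(phi i x) (positiveZ (unital_positive_functional (hphi i))).
  rewrite /cabs normc_def sqr_sqrtr ?addr_ge0 ?sqr_ge0 //.
  by case: (phi i x) => a b /=; rewrite mul0r mul1r sub0r sqrrN.
set u := (X in limn_einf X).
apply: le_ereal_of_lt_fin => r rsup.
have /(frequently_ultrafilter (nat_subnet_directed hN)) [G [GU tails GE]] :=
  lt_net_limsup_frequently rsup.
have inv y : complex.Re (phi i (S y)) - complex.Re (phi i y) @[i --> G] --> (0 : R).
  exact: pulled_average_asymptotically_invariant.
pose psi := ultralimit_re G phi.
have psi_cvg := @ultralimit_re_cvg _ _ _ G phi GU hphi.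
(* P fixes the value phi v = phi x of the limit functional, so that
   B v v >= |phi v|^2 gives the same lower bound on all of P. *)
pose P v := psi v = psi x /\ psi ('i%C *: v) = psi ('i%C *: x).
have form := ultralimit_form GU hphi.
have contr := ultralimit_form_contraction hS GU hphi inv.
have rq : r <= psi x ^+ 2 + psi ('i%C *: x) ^+ 2.
  have sqr_cvg y : complex.Re (phi i y) ^+ 2 @[i --> G] --> psi y ^+ 2.
    rewrite expr2; under eq_fun do rewrite expr2.
    by apply: cvgM; exact: psi_cvg.
  apply: (cvgr_to_ge (cvgD (sqr_cvg x) (sqr_cvg ('i%C *: x)))).
  by apply: filterS GE => i /ltW.
apply/lee_subgt0Pr => e e0.
have [||||n hn] := @orbit_average_form_ge _ _ _ S form contr P x
  (psi x ^+ 2 + psi ('i%C *: x) ^+ 2) e _ _ _ _ e0.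
- move=> t a b _ [Pa Pia] [Pb Pib]; split.
    rewrite /psi ultralimit_reD // !ultralimit_reZ // -/psi Pa Pb; ring.
  rewrite scalerDr !scalerA ![_ * _%:C]mulrC -!scalerA.
  rewrite /psi ultralimit_reD // !ultralimit_reZ // -/psi Pia Pib; ring.
- move=> v [Pv Piv]; split; first by rewrite /psi ultralimit_re_invariant.
  by rewrite -linearZ /psi ultralimit_re_invariant.
- by [].
- by move=> v [<- <-]; exact: ultralimit_re_sqr_le.
rewrite limn_einf_lim; apply: lime_ge; first exact: is_cvg_einfs.
exists n => // m /= nm; apply: le_ereal_inf_tmp => _ [J /= mJ <-].
rewrite -EFinB; apply: (@le_trans _ _ (psi (star (orbit_average S x J) *c x))%:E).
  by rewrite lee_fin (le_trans _ (hn J (leq_trans nm mJ))) // lerB.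
have -> : psi (star (orbit_average S x J) *c x) =
    J%:R^-1 * \sum_(1 <= j < J.+1) psi (star (iter j S x) *c x).
  by rewrite -(form_suml form) -(form_scalel form).
rewrite /u EFinM -sumEFin.
apply: lee_wpmul2l; first by rewrite lee_fin invr_ge0.
apply: lee_sum => j _; apply: (cvg_le_net_limsup _ tails).
under eq_fun do rewrite -Re_pulled_average.
exact: psi_cvg.
Qed.
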